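(* Let $\bar x\in\mathcal F$ be a feasible point of the constraint system $x\in C$, $G(x)\in K$, and assume that Robinson's constraint qualification is satisfied at $\bar x$. Then $\bar x$ is sw-AKKT regular (and, thus, s-AKKT regular).
   Context: Setting: $X$ and $Y$ are real Banach spaces, $G\colon X\to Y$ is continuously Fréchet differentiable, $C\subset X$ and $K\subset Y$ are nonempty, closed, convex sets, and $\mathcal F:=\{x\in C\mid G(x)\in K\}$. For a closed convex set $S$ and $x\in S$, the radial cone is $\mathcal R_S(x):=\{\alpha(z-x)\mid\alpha\ge0,\ z\in S\}$. Robinson's constraint qualification (RCQ) holds at $\bar x\in\mathcal F$ if $Y=G'(\bar x)\,\mathcal R_C(\bar x)-\mathcal R_K(G(\bar x))$. $\mathcal N_C(x):=\{v\in X^*\mid\langle v,z-x\rangle_X\le0\ \forall z\in C\}$ for $x\in C$ and $\mathcal N_C(x):=\varnothing$ for $x\notin C$. For $x\in X$ and $r\ge0$ let $$\mathcal M(x,r):=\{G'(x)^*\lambda+\mu\in X^*\mid \lambda\in Y^*,\ \mu\in\mathcal N_C(x),\ \langle\lambda,y-G(x)\rangle_Y\le r\ \forall y\in K\}.$$ A point $\bar x\in\mathcal F$ is sw-AKKT regular if every $\bar v\in X^*$ for which there exist sequences $\{x^k\}\subset X$, $\{r^k\}\subset[0,+\infty)$, $\{v^k\}\subset X^*$ with $x^k\to\bar x$ (strongly), $r^k\to0$, $v^k\rightharpoonup^*\bar v$ (weak* ) and $v^k\in\mathcal M(x^k,r^k)$ for all $k$ belongs to $\mathcal M(\bar x,0)$.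 It is s-AKKT regular if the same holds with $v^k\to\bar v$ (strongly) in place of $v^k\rightharpoonup^*\bar v$. *)

(* Defs.v *)
From HB Require Import structures.
From mathcomp Require Import all_boot all_order all_algebra.
From mathcomp Require Import all_classical all_reals all_analysis.

Set Implicit Arguments.
Unset Strict Implicit.
Unset Printing Implicit Defensive.

Import Order.TTheory GRing.Theory Num.Theory.
Import numFieldNormedType.Exports.

Local Open Scope classical_set_scope.
Local Open Scope ring_scope.

(* The library has no type of bounded linear maps.  They are handled as plain
   functions, and X^* is the set [dual X] of functions X -> R^o. *)
Definition dual (R : realType) (X : normedModType R) : set (X -> R^o) :=
  [set f | linear f /\ continuous f].
Arguments dual {R} X.

(* [sup] is 0 on unbounded sets, so this is the operator norm only when T is
   linear and continuous, as in all the uses below. *)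
Definition opnorm (R : realType) (X Y : normedModType R) (T : X -> Y) : R :=
  sup [set `|T x| | x in [set x : X | `|x| <= 1]].

Definition continuously_differentiable (R : realType) (X Y : normedModType R)
    (G : X -> Y) : Prop :=
  (forall x : X, differentiable G x) /\
  (forall x : X, opnorm (fun h => 'd G z h - 'd G x h) @[z --> x] --> (0 : R)).

Section constraint_system.
Variables (R : realType) (X Y : normedModType R).
Implicit Types (G : X -> Y) (C : set X) (K : set Y) (x : X).

Definition feasible G C K : set X := C `&` G @^-1` K.

Definition radial_cone (Z : normedModType R) (S : set Z) (x : Z) : set Z :=
  [set a *: (z - x) | a in [set a : R | 0 <= a] & z in S].

Definition RCQ G C K x : Prop :=
  [set: Y] =
  [set 'd G x d - e | d in radial_cone C x & e in radial_cone K (G x)].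

Definition normal_cone C x : set (X -> R^o) :=
  [set v | [/\ C x, dual X v & forall z, C z -> v (z - x) <= 0]].

(* The composite lam \o 'd G x is the adjoint G'(x)^* applied to lam. *)
Definition Mset G C K x (r : R) : set (X -> R^o) :=
  [set w | exists lam mu, [/\ dual Y lam, normal_cone C x mu,
    (forall y, K y -> lam (y - G x) <= r) &
    w = (lam \o 'd G x) \+ mu]].

Definition weakstar_cvg (v : nat -> X -> R^o) (vbar : X -> R^o) : Prop :=
  forall h, v k h @[k --> \oo] --> vbar h.

Definition strong_cvg (v : nat -> X -> R^o) (vbar : X -> R^o) : Prop :=
  opnorm (fun h => v k h - vbar h) @[k --> \oo] --> (0 : R).

Definition AKKT_regular
    (dual_cvg : (nat -> X -> R^o) -> (X -> R^o) -> Prop) G C K (xbar : X) : Prop :=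
  forall vbar, dual X vbar ->
  (exists (xs : nat -> X) (rs : nat -> R) (vs : nat -> X -> R^o),
     [/\ (forall k, 0 <= rs k) /\ (forall k, dual X (vs k)),
         xs @ \oo --> xbar,
         rs @ \oo --> (0 : R),
         dual_cvg vs vbar &
         forall k, Mset G C K (xs k) (rs k) (vs k)]) ->
  Mset G C K xbar 0 vbar.

Definition sw_AKKT_regular := AKKT_regular weakstar_cvg.

Definition s_AKKT_regular := AKKT_regular strong_cvg.

End constraint_system.

(* Main.v *)
(* For each fixed y, RCQ writes y as G'(xbar) d - e with d and e radial, and
   this turns the inclusion v^k in M(x^k, r^k) into a lower bound
   lambda^k(y) >= - M_y (1 + s_k |lambda^k|) with s_k -> 0.  Banach-Steinhaus
   applied to lambda^k / (1 + s_k |lambda^k|) then bounds |lambda^k| for large k,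
   without any appeal to the generalized open mapping theorem.  A weak* limit of
   lambda^k along an ultrafilter is the required multiplier: Y need not be
   separable, so weak* convergent subsequences may fail to exist. *)
Require Import Defs.
From HB Require Import structures.
From mathcomp Require Import all_boot all_order all_algebra.
From mathcomp Require Import all_classical all_reals all_analysis.
From mathcomp Require Import lra.

Set Implicit Arguments.
Unset Strict Implicit.
Unset Printing Implicit Defensive.

Import Order.TTheory GRing.Theory Num.Theory.
Import numFieldNormedType.Exports.

Local Open Scope classical_set_scope.
Local Open Scope ring_scope.

(** * Linear maps as plain functions, and their operator norm *)

Section linear_maps.
Variables (R : realType) (V W : normedModType R).
Implicit Types f : V -> W.

Lemma linear_fun0 f : linear f -> f 0 = 0.
Proof. by move=> lf; have := lf (-1) 0 0; rewrite scaler0 addr0 scaleN1r addNr. Qed.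

Lemma linear_funD f : linear f -> {morph f : x y / x + y}.
Proof. by move=> lf x y; have := lf 1 x y; rewrite !scale1r. Qed.

Lemma linear_funZ f : linear f -> forall a x, f (a *: x) = a *: f x.
Proof. by move=> lf a x; have := lf a x 0; rewrite linear_fun0// !addr0. Qed.

Lemma linear_funN f : linear f -> {morph f : x / - x}.
Proof. by move=> lf x; rewrite -scaleN1r linear_funZ// scaleN1r. Qed.

Lemma linear_funB f : linear f -> {morph f : x y / x - y}.
Proof. by move=> lf x y; rewrite linear_funD// linear_funN. Qed.

Lemma linear_fun_sub f g : linear f -> linear g -> linear (fun x => f x - g x).
Proof.
move=> lf lg a x y; rewrite lf lg scalerBr opprD !addrA; congr (_ - _).
by rewrite addrAC.
Qed.

Lemma continuous_linear_lipschitz f : linear f -> continuous f ->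
  exists2 k, 0 < k & forall x, `|f x| <= k * `|x|.
Proof.
move=> lf cf.
pose F : {linear V -> W} := HB.pack f (GRing.isLinear.Build _ _ _ _ _ lf).
exact: (@linear_lipschitz _ _ _ F).
Qed.

Lemma lipschitz_linear_continuous f k : linear f ->
  (forall x, `|f x| <= k * `|x|) -> continuous f.
Proof.
move=> lf fk.
pose F : {linear V -> W} := HB.pack f (GRing.isLinear.Build _ _ _ _ _ lf).
apply: (@bounded_linear_continuous _ _ _ F); apply/linear_boundedP.
exists k; split; first exact: num_real.
by move=> r /ltW kr x; rewrite (le_trans (fk x))// ler_wpM2r.
Qed.

Lemma opnorm_has_ubound f : linear f -> continuous f ->
  has_ubound [set `|f x| | x in [set x : V | `|x| <= 1]].
Proof.
move=> lf cf; have [k k0 fk] := continuous_linear_lipschitz lf cf.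
exists k => _ [y /= y1 <-]; apply: (le_trans (fk y)).
by rewrite -[leRHS]mulr1 ler_wpM2l// ltW.
Qed.

Lemma opnorm_ge0 f : linear f -> continuous f -> 0 <= opnorm f.
Proof.
move=> lf cf; apply: ub_le_sup; first exact: opnorm_has_ubound.
by exists 0; rewrite /= ?linear_fun0// normr0.
Qed.

Lemma le_opnorm f x : linear f -> continuous f -> `|f x| <= opnorm f * `|x|.
Proof.
move=> lf cf; have [->|x0] := eqVneq x 0.
  by rewrite linear_fun0// !normr0 mulr0.
have nx0 : 0 < `|x| by rewrite normr_gt0.
rewrite -ler_pdivrMr// mulrC -[X in X * _]ger0_norm ?invr_ge0//.
rewrite -normrZ -linear_funZ//; apply: ub_le_sup; first exact: opnorm_has_ubound.
by exists (`|x|^-1 *: x) => //=; rewrite normrZ normfV normr_id mulVf ?gt_eqF.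
Qed.

Lemma opnorm_le f k : 0 <= k -> (forall x, `|f x| <= k * `|x|) -> opnorm f <= k.
Proof.
move=> k0 fk; apply: ge_sup; first by exists `|f 0|, 0 => //=; rewrite normr0.
by move=> _ [x /= x1 <-]; rewrite (le_trans (fk x))// ler_piMr.
Qed.

End linear_maps.

(** * Uniform boundedness and limits of pairings *)

Lemma cvgn_norm_bound (R : realType) (V : normedModType R) (u : nat -> V) (l : V) :
  u @ \oo --> l -> exists2 M, 0 <= M & forall k, `|u k| <= M.
Proof.
move=> ul; have [M [_ uM]] := cvg_seq_bounded (cvgP _ ul).
exists (Num.max 0 (M + 1)) => [|k]; first by rewrite le_max lexx.
by rewrite le_max (uM (M + 1)) ?orbT// ltrDl.
Qed.

Lemma banach_steinhaus_seq (R : realType) (V : completeNormedModType R)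
    (W : normedModType R) (f : nat -> V -> W) :
  (forall k, linear (f k)) -> (forall k, continuous (f k)) ->
  (forall x, exists M, forall k, `|f k x| <= M) ->
  exists2 M, 0 < M & forall k x, `|f k x| <= M * `|x|.
Proof.
move=> lf cf fb.
(* Radius 1 turns the uniform bound on balls into a bound on all operator norms. *)
have [|x|M fM] := @Banach_Steinhauss _ _ _ (range f) _ _ 1.
- move=> _ [k _ <-]; split => // r.
  have [m m0 fm] := continuous_linear_lipschitz (lf k) (cf k).
  by exists (m * r) => x xr; rewrite (le_trans (fm x))// ler_wpM2l// ltW.
- by have [M fM] := fb x; exists M => _ [k _ <-].
have M1 : 0 < Num.max M 1 by rewrite lt_max ltr01 orbT.
exists (Num.max M 1) => // k x.
apply: (@le_trans _ _ (opnorm (f k) * `|x|)); first exact: le_opnorm.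
apply: ler_wpM2r => //; apply: ge_sup.
  by exists `|f k 0|, 0 => //=; rewrite normr0.
by move=> _ [y /= y1 <-]; rewrite le_max (fM (f k))//; exists k.
Qed.

(** In [f k (u k - l) + f k l] the first term is at most [M * |u k - l|] in norm. The filter is
    arbitrary because both [\oo] and an ultrafilter occur later. *)
Lemma cvg_pairing (R : realType) (V W : normedModType R) (T : Type)
    (F : set_system T) (FF : Filter F) (f : T -> V -> W) (g : V -> W) (M : R)
    (u : T -> V) (l : V) :
  (forall k, linear (f k)) ->
  (\forall k \near F, forall x, `|f k x| <= M * `|x|) ->
  (f k l @[k --> F] --> g l) -> u @ F --> l -> f k (u k) @[k --> F] --> g l.
Proof.
move=> lf fM fl ul.
have -> : (fun k => f k (u k)) = (fun k => f k (u k - l) + f k l).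
  by apply/funext => k; rewrite -linear_funD// subrK.
rewrite -[g l]add0r; apply: cvgD => //; apply: norm_cvg0.
apply: (@squeeze_cvgr _ _ _ _ (cst 0) (fun k => M * `|u k - l|)).
- by apply: filterS fM => k; rewrite normr_ge0/=; apply.
- exact: cvg_cst.
- rewrite -[X in _ --> X](mulr0 M); apply: cvgMl_tmp.
  rewrite -[X in _ --> X](@normr0 _ V) ; apply: cvg_norm.
  by rewrite -(subrr l); apply: cvgB => //; exact: cvg_cst.
Qed.

(** The error [f k (u k) - g (u k)] is at most the operator norm of the difference times [|u k|].
    This serves the derivatives along [xs] and the passage from strong to weak* convergence. *)
Lemma cvg_opnorm_pairing (R : realType) (V W : normedModType R) (T : Type)
    (F : set_system T) (FF : Filter F) (f : T -> V -> W) (g : V -> W)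
    (u : T -> V) (l : V) :
  (forall k, linear (f k) /\ continuous (f k)) -> linear g -> continuous g ->
  opnorm (fun h => f k h - g h) @[k --> F] --> (0 : R) ->
  u @ F --> l -> f k (u k) @[k --> F] --> g l.
Proof.
move=> fP lg cg fg ul.
have lB k : linear (fun h => f k h - g h).
  by apply: linear_fun_sub => //; exact: (fP k).1.
have cB k : continuous (fun h => f k h - g h).
  by move=> x; apply: cvgB; [exact: (fP k).2|exact: cg].
have -> : (fun k => f k (u k)) = (fun k => (f k (u k) - g (u k)) + g (u k)).
  by apply/funext => k; rewrite subrK.
rewrite -[g l]add0r; apply: cvgD; last exact: (cvg_comp _ _ ul (cg l)).
apply: norm_cvg0.
apply: (@squeeze_cvgr _ _ _ _ (cst 0)
  (fun k => opnorm (fun h => f k h - g h) * `|u k|)).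
- by apply: nearW => k; rewrite normr_ge0/=; exact: (le_opnorm _ (lB k) (cB k)).
- exact: cvg_cst.
- by rewrite -(mul0r `|l|); apply: cvgM => //; exact: cvg_norm.
Qed.

(** * Weak* limits along ultrafilters and bounds on functionals *)

Lemma ultra_bounded_cvg (R : realType) (T : Type) (U : set_system T)
    (UU : UltraFilter U) (u : T -> R^o) (M : R) :
  (\forall k \near U, `|u k| <= M) -> exists l : R^o, u @ U --> l.
Proof.
move=> uM; have UM : (u @ U) `[- M, M]%classic.
  by apply: filterS uM => k; rewrite /= in_itv/= ler_norml.
have [l [_ ul]] := @segment_compact R (- M) M (u @ U) _ UM.
(* An ultrafilter converges to its cluster point [l]: it cannot contain the complement of a
   neighbourhood of [l]. *)
exists l => A Al; have [//|UnA] := in_ultra_setVsetC (u @^-1` A) UU.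
by have [? []] := ul (~` A) A UnA Al.
Qed.

(** The Banach-Alaoglu theorem in ultrafilter form: the limit is built pointwise, and linearity and
    the bound [M] pass to it. *)
Lemma ultra_weakstar_cvg (R : realType) (V : normedModType R) (T : Type)
    (U : set_system T) (UU : UltraFilter U) (f : T -> V -> R^o) (M : R) :
  (forall k, linear (f k)) -> (\forall k \near U, forall x, `|f k x| <= M * `|x|) ->
  exists2 g, dual V g & forall x, f k x @[k --> U] --> g x.
Proof.
move=> lf fM.
have /choice[g fg] x : exists l : R^o, f k x @[k --> U] --> l.
  by apply: (@ultra_bounded_cvg _ _ _ _ _ (M * `|x|)); exact: filterS fM.
have lg : linear g.
  move=> a x y; have fE : (fun k => f k (a *: x + y)) = (fun k => a *: f k x + f k y).
    by apply/funext => k; rewrite lf.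
  have := fg (a *: x + y); rewrite fE => /(@cvg_unique _ (@norm_hausdorff _ _) _ _ _ _); apply.
  by apply: (@cvgD _ R^o _ U _ (fun k => a *: f k x)); [exact: cvgZl_tmp|exact: fg].
exists g => //; split => //; apply: (lipschitz_linear_continuous (k := M)) => // x.
apply: (@cvgr_to_le T U _ R (fun k => `|f k x|)); first exact: cvg_norm.
exact: filterS fM.
Qed.

(* The weights [1 + s k * opnorm (lam k)] turn the hypothesis into pointwise
   boundedness of the rescaled functionals; since [s] tends to 0, the resulting
   uniform bound can be solved for [opnorm (lam k)]. *)
Lemma dual_seq_bounded (R : realType) (V : completeNormedModType R)
    (lam : nat -> V -> R^o) (s : nat -> R) :
  (forall k, dual V (lam k)) -> (forall k, 0 <= s k) -> s @ \oo --> (0 : R) ->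
  (forall y, exists M, forall k, - (M * (1 + s k * opnorm (lam k))) <= lam k y) ->
  exists M, \forall k \near \oo, forall y, `|lam k y| <= M * `|y|.
Proof.
move=> dlam s0 scvg lamb.
pose d k := 1 + s k * opnorm (lam k).
have L0 k : 0 <= opnorm (lam k) by apply: opnorm_ge0; case: (dlam k).
have d0 k : 0 < d k by rewrite ltr_pwDl// mulr_ge0.
have [||y|M M0 lamM] :=
    @banach_steinhaus_seq R V R^o (fun k y => (d k)^-1 *: lam k y).
- by move=> k a x y; rewrite (dlam k).1 scalerDr !scalerA mulrC.
- by move=> k x; apply: cvgZl_tmp; exact: (dlam k).2.
(* The hypothesis bounds only from below; its instance at [- y] supplies the upper bound. *)
- have [M1 lamM1] := lamb y; have [M2 lamM2] := lamb (- y).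
  exists (Num.max M1 M2) => k.
  rewrite normrZ ger0_norm ?invr_ge0 ?(ltW (d0 k))// ler_pdivrMl// ler_norml.
  apply/andP; split.
    apply: le_trans (lamM1 k); rewrite lerN2 mulrC ler_wpM2l ?(ltW (d0 k))//.
    by rewrite le_max lexx.
  rewrite -lerN2 -[- lam k y](linear_funN (dlam k).1); apply: le_trans (lamM2 k).
  by rewrite lerN2 mulrC ler_wpM2l ?(ltW (d0 k))// le_max lexx orbT.
(* Write L for [opnorm (lam k)]. Once [s k * M <= 1/2], the bound [L <= (1 + s k * L) * M] gives
   [L <= 2 * M], and then [(1 + s k * L) * M <= M + L / 2 <= 2 * M]. *)
exists (2 * M).
have : \forall k \near \oo, `|s k| <= (2 * M)^-1.
  by apply: cvgr0_norm_le => //; rewrite invr_gt0 mulr_gt0.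
apply: filterS => k; rewrite ger0_norm// => sk y.
have lamdM z : `|lam k z| <= d k * M * `|z|.
  have := lamM k z.
  by rewrite normrZ ger0_norm ?invr_ge0 ?(ltW (d0 k))// ler_pdivrMl// mulrA.
have LM : opnorm (lam k) <= d k * M.
  by apply: opnorm_le => //; rewrite mulr_ge0// ltW.
apply: (le_trans (lamdM y)); apply: ler_wpM2r => //.
have : s k * M <= 2^-1.
  rewrite -ler_pdivlMr//; apply: (le_trans sk).
  by rewrite invfM mulrC.
rewrite /d in LM *; have := L0 k; have := s0 k; nra.
Qed.

Lemma strong_weakstar_cvg (R : realType) (V : normedModType R)
    (v : nat -> V -> R^o) (vbar : V -> R^o) :
  (forall k, dual V (v k)) -> dual V vbar -> strong_cvg v vbar ->
  weakstar_cvg v vbar.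
Proof.
move=> dv [lvbar cvbar] vvbar h.
by apply: cvg_opnorm_pairing => //; exact: cvg_cst.
Qed.

(** * Multipliers of an AKKT sequence under Robinson's condition *)

Section RCQ_regularity.
Variables (R : realType) (X Y : completeNormedModType R).
Variables (G : X -> Y) (C : set X) (K : set Y) (xbar : X).
Hypothesis G_C1 : continuously_differentiable G.
Hypothesis xbar_RCQ : RCQ G C K xbar.
Variables (xs : nat -> X) (rs : nat -> R) (vs : nat -> X -> R^o).
Variable vbar : X -> R^o.
Hypothesis dvs : forall k, dual X (vs k).
Hypothesis dvbar : dual X vbar.
Hypothesis xs_cvg : xs @ \oo --> xbar.
Hypothesis rs_cvg : rs @ \oo --> (0 : R).
Hypothesis vs_cvg : weakstar_cvg vs vbar.
Variables (lam : nat -> Y -> R^o) (mu : nat -> X -> R^o).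
Hypothesis dlam : forall k, dual Y (lam k).
Hypothesis mu_normal : forall k, normal_cone C (xs k) (mu k).
Hypothesis lam_le : forall k y, K y -> lam k (y - G (xs k)) <= rs k.
Hypothesis vsE : forall k, vs k = (lam k \o 'd G (xs k)) \+ mu k.

Let diff_linear x : linear ('d G x).
Proof. exact: linearP. Qed.

Let diff_cont x : continuous ('d G x).
Proof. by move=> y; apply: diff_continuous; exact: G_C1.1. Qed.

Let diff_diff_linear x : linear (fun h => 'd G x h - 'd G xbar h).
Proof. by apply: linear_fun_sub; exact: diff_linear. Qed.

Let diff_diff_cont x : continuous (fun h => 'd G x h - 'd G xbar h).
Proof. by move=> h; apply: cvgB; exact: diff_cont. Qed.

Let opnorm_cvg : opnorm (fun h => 'd G (xs k) h - 'd G xbar h) @[k --> \oo] --> (0 : R).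
Proof. exact: (cvg_comp _ _ xs_cvg (G_C1.2 xbar)). Qed.

Let G_xs_cvg : G (xs k) @[k --> \oo] --> G xbar.
Proof.
exact: (cvg_comp _ _ xs_cvg (differentiable_continuous (G_C1.1 xbar))).
Qed.

Let diff_xs_cvg (u : nat -> X) (l : X) : u @ \oo --> l ->
  'd G (xs k) (u k) @[k --> \oo] --> 'd G xbar l.
Proof.
by move=> ul; apply: (@cvg_opnorm_pairing _ _ _ _ _ _ (fun k => 'd G (xs k))).
Qed.

(** By Banach-Steinhaus on the complete space [X], the weak* convergent [vs] is bounded, so its
    argument may move along a strongly convergent sequence. *)
Let vs_pairing (u : nat -> X) (l : X) : u @ \oo --> l ->
  vs k (u k) @[k --> \oo] --> vbar l.
Proof.
move=> ul.
have [|||M M0 vM] := @banach_steinhaus_seq _ _ _ vs.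
- by move=> k; case: (dvs k).
- by move=> k; case: (dvs k).
- by move=> x; have [M _ vM] := cvgn_norm_bound (@vs_cvg x); exists M.
apply: (@cvg_pairing _ _ _ _ _ _ _ _ M) => //.
- by move=> k; case: (dvs k).
- exact: nearW.
Qed.

Lemma multipliers_bounded :
  exists M, \forall k \near \oo, forall y, `|lam k y| <= M * `|y|.
Proof.
pose delta k := opnorm (fun h => 'd G (xs k) h - 'd G xbar h).
have delta0 k : 0 <= delta k by apply: opnorm_ge0.
(* [s k] collects the errors that get multiplied by the norm of [lam k]: replacing the derivative at
   [xs k] by that at [xbar], [xs k] by [xbar] in the direction, and [G (xs k)] by [G xbar]. *)
pose s k := delta k + `|'d G (xs k) (xbar - xs k)| + `|G (xs k) - G xbar|.
have xs0 : xbar - xs k @[k --> \oo] --> (0 : X).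
  by rewrite -(subrr xbar); apply: cvgB => //; exact: cvg_cst.
have s_cvg : s @ \oo --> (0 : R).
  rewrite -[0](addr0 0) -[X in _ --> X + _](addr0 0).
  apply: cvgD; first apply: cvgD => //.
    rewrite -(@normr0 _ Y) -(linear0 ('d G xbar)); apply: cvg_norm.
    exact: diff_xs_cvg.
  rewrite -(@normr0 _ Y) -(subrr (G xbar)); apply: cvg_norm.
  by apply: cvgB => //; exact: cvg_cst.
apply: (dual_seq_bounded dlam _ s_cvg) => [k|y]; first by rewrite !addr_ge0.
have : [set: Y] y by [].
rewrite xbar_RCQ => -[_ [a /= a0 [c Cc <-]] [_ [b /= b0 [e Ke <-]] <-]].
have [V V0 vV] : exists2 V, 0 <= V & forall k, `|vs k (c - xs k)| <= V.
  apply: (@cvgn_norm_bound _ R^o _ (vbar (c - xbar))).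
  by apply: vs_pairing; apply: cvgB => //; exact: cvg_cst.
have [r r0 rsr] := cvgn_norm_bound (rs_cvg : (rs : nat -> R^o) @ \oo --> (0 : R^o)).
(* Here [y] is the image of [a *: (c - xbar)] minus [b *: (e - G xbar)]. The terms with [V] and [r]
   come from [vs] and [rs]; the other two are the coefficients of [s k * opnorm (lam k)]. *)
exists (a * V + a * (`|c - xbar| + 1) + b * r + b) => k.
have [ll cl] := dlam k.
have L0 : 0 <= opnorm (lam k) by exact: opnorm_ge0.
have lamN z : - (opnorm (lam k) * `|z|) <= lam k z.
  have := le_opnorm z ll cl; rewrite ler_norml => /andP[+ _].
  exact.
have s0 : 0 <= s k by rewrite !addr_ge0.
rewrite (linear_funB ll) (linear_funZ ll b) (linear_funZ (diff_linear xbar)) (linear_funZ ll a).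
(* Since [mu k (c - xs k) <= 0], the value of [lam k] at the derivative in [xs k] along [c - xs k]
   is at least [vs k (c - xs k) >= - V]. In the error, [|c - xbar|] weights the derivative
   difference and the added 1 covers the shift of direction. *)
have lam_c : - V - opnorm (lam k) * (s k * (`|c - xbar| + 1)) <=
    lam k ('d G xbar (c - xbar)).
  have -> : 'd G xbar (c - xbar) = 'd G (xs k) (c - xs k) +
      ('d G xbar (c - xbar) - 'd G (xs k) (c - xs k)).
    by rewrite addrCA subrr addr0.
  rewrite (linear_funD ll); apply: lerD.
    have [_ _ /(_ c Cc) mu0] := mu_normal k.
    have := vV k; rewrite ler_norml => /andP[+ _].
    rewrite vsE /= => Vle; apply: (le_trans Vle).
    by rewrite gerDl.
  apply: le_trans (lamN _); rewrite lerN2 ler_wpM2l//.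
  have -> : 'd G xbar (c - xbar) - 'd G (xs k) (c - xs k) =
      - ('d G (xs k) (c - xbar) - 'd G xbar (c - xbar)) - 'd G (xs k) (xbar - xs k).
    rewrite opprB -addrA -opprD -linearD/=.
    by rewrite addrA subrK.
  apply: (le_trans (ler_normB _ _)); rewrite normrN.
  have := le_opnorm (c - xbar) (@diff_diff_linear (xs k)) (@diff_diff_cont (xs k)).
  rewrite -/(delta k) /=.
  have := normr_ge0 (c - xbar); have := normr_ge0 ('d G (xs k) (xbar - xs k)).
  have := normr_ge0 (G (xs k) - G xbar); have := delta0 k.
  rewrite /s; nra.
have lam_e : lam k (e - G xbar) <= r + opnorm (lam k) * s k.
  have -> : e - G xbar = (e - G (xs k)) + (G (xs k) - G xbar).
    by rewrite addrA subrK.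
  rewrite (linear_funD ll); apply: lerD.
    apply: (le_trans (lam_le k Ke)); apply: le_trans (rsr k); exact: ler_norm.
  apply: (le_trans (ler_norm _)); apply: (le_trans (le_opnorm _ ll cl)).
  by rewrite ler_wpM2l// /s lerDr addr_ge0.
have ac := ler_wpM2l a0 lam_c.
have be := ler_wpM2l b0 lam_e.
apply: (le_trans _ (lerB ac be)).
(* The claimed bound exceeds the one obtained by nonnegative surplus terms, since every coefficient
   is multiplied by the whole of [1 + s k * opnorm (lam k)]. *)
have t0 : 0 <= s k * opnorm (lam k) by rewrite mulr_ge0.
have h1 := mulr_ge0 (mulr_ge0 a0 V0) t0.
have h2 : 0 <= a * (`|c - xbar| + 1) by rewrite mulr_ge0// addr_ge0.
have h3 := mulr_ge0 (mulr_ge0 b0 r0) t0.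
lra.
Qed.

Lemma multiplier_limit (Cx : C xbar) : Mset G C K xbar 0 vbar.
Proof.
have [M lamM] := multipliers_bounded.
(* [U] refines [\oo], so all sequential limits and eventual bounds persist along it. *)
have [U [UU subU]] := ultraFilterLemma (eventually_filter : ProperFilter \oo).
have oo_U (T : topologicalType) (u : nat -> T) (l : T) :
  u @ \oo --> l -> u @ U --> l by move=> ul A /ul /subU.
have lamU : \forall k \near U, forall y, `|lam k y| <= M * `|y| by exact: subU.
have ll k : linear (lam k) by case: (dlam k).
have [lbar [llbar clbar] lamlbar] := ultra_weakstar_cvg UU ll lamU.
have lam_pairing u l : u @ \oo --> l -> lam k (u k) @[k --> U] --> lbar l.
  by move=> ul; apply: (@cvg_pairing _ _ _ _ U _ lam lbar M) => //; exact: oo_U.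
have [lvbar cvbar] := dvbar.
(* The normal-cone part is forced by the required decomposition of [vbar]; it is the pointwise limit
   of [mu k] along [U], and so inherits the normality inequalities. *)
exists lbar, (fun h => vbar h - lbar ('d G xbar h)); split => //.
- split => //.
    split.
      apply: linear_fun_sub => // a x y; rewrite diff_linear; exact: llbar.
    move=> x; apply: cvgB; first exact: cvbar.
    by apply: continuous_comp; [exact: diff_cont|exact: clbar].
  move=> z Cz.
  have zxs : z - xs k @[k --> \oo] --> z - xbar.
    by apply: cvgB => //; exact: cvg_cst.
  apply: (@cvgr_to_le _ U _ R (fun k => mu k (z - xs k))).
    have -> : (fun k => mu k (z - xs k)) =
        (fun k => vs k (z - xs k) - lam k ('d G (xs k) (z - xs k))).
      by apply/funext => k; rewrite vsE /= addrAC subrr add0r.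
    apply: cvgB; first exact/oo_U/vs_pairing.
    exact/lam_pairing/diff_xs_cvg.
  by apply: nearW => k; case: (mu_normal k) => _ _; exact.
- move=> y Ky.
  (* The relaxed inequality becomes exact because its right-hand side [rs] tends to 0. *)
  apply: (@ler_cvg_to _ U _ R (fun k => lam k (y - G (xs k))) rs).
  + by apply: lam_pairing; apply: cvgB => //; exact: cvg_cst.
  + exact: oo_U.
  + by apply: nearW => k; exact: lam_le.
- by apply/funext => h /=; rewrite addrC subrK.
Qed.

End RCQ_regularity.

Lemma RCQ_sw_AKKT_regular (R : realType) (X Y : completeNormedModType R)
    (G : X -> Y) (C : set X) (K : set Y) (xbar : X) :
  continuously_differentiable G -> C xbar -> RCQ G C K xbar ->
  sw_AKKT_regular G C K xbar.
Proof.
move=> G_C1 Cx rcq vbar dvbar [xs [rs [vs [[_ dvs] xsx rs0 vsv vsM]]]].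
have /choice[lam /choice[mu lamP]] := vsM.
apply: (@multiplier_limit _ _ _ G C K xbar G_C1 rcq xs rs vs vbar dvs dvbar
  xsx rs0 vsv lam mu) => // k; by case: (lamP k).
Qed.

Theorem theorem5p2 (R : realType) (X Y : completeNormedModType R)
    (G : X -> Y) (C : set X) (K : set Y) (xbar : X)
    (G_C1 : continuously_differentiable G)
    (C_neq0 : C !=set0) (C_closed : closed C)
    (C_convex : convex_set (C : set (convex_lmodType X)))
    (K_neq0 : K !=set0) (K_closed : closed K)
    (K_convex : convex_set (K : set (convex_lmodType Y)))
    (xbar_feasible : feasible G C K xbar)
    (xbar_RCQ : RCQ G C K xbar) :
  sw_AKKT_regular G C K xbar /\ s_AKKT_regular G C K xbar.
Proof.
have sw : sw_AKKT_regular G C K xbar.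
  by apply: RCQ_sw_AKKT_regular => //; case: xbar_feasible.
split => // vbar dvbar [xs [rs [vs [[rs0 dvs] xsx rsc vsv vsM]]]].
apply: sw => //; exists xs, rs, vs; split => //.
exact: strong_weakstar_cvg.
Qed.
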